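(* Let $k$ be a field, let $p\ge 1$, and let $a,b\in\{1,\ldots,p\}$. Equip $H=\mathsf{k}[\lambda_p](0)$ with the coproduct $\Delta$ determined by the parameters $q_{1j}=\delta_{aj}$ and $q_{2j}=\delta_{bj}$, and let $*$ be the resulting (dual) multiplication on the graded dual $H^*$, graded by the number of applications of $\lambda_p$ in trees. Then the augmentation ideal of $H^*$ is a graded dendriform algebra with associated multiplication $*$; that is, there are degree-preserving bilinear operations $\prec$ and $\succ$ on the augmentation ideal satisfying the dendriform identities and such that $x*y=x\prec y+x\succ y$ for all $x,y$ in the augmentation ideal.
   Context: A dendriform algebra is a vector space with two bilinear products $\prec,\succ$ satisfying $(x\prec y)\prec z=x\prec(y\prec z)+x\prec(y\succ z)$, $\ x\succ(y\prec z)=(x\succ y)\prec z$, $\ x\succ(y\succ z)=(x\prec y)\succ z+(x\succ y)\succ z$. Its associated multiplication is $x*y=x\prec y+x\succ y$, which is associative. It is graded if $x\prec y$ and $x\succ y$ have degree $m+m'$ for $x$ of degree $m$ and $y$ of degree $m'$. $H=\mathsf{k}[\lambda_p](0)$ is the initial object among pairs of a pointed $k$-vector space $A$ (a vector space with a chosen element $1$) and a linear map $A^{\otimes p}\to A$. It has as basis the trees defined recursively: $1=\emptyset$ (the empty tree) is a tree, and $\lambda(t_1,\ldots,t_p)$ is a tree whenever $t_1,\ldots,t_p$ are; here $\lambda=\lambda_p:H^{\otimes p}\to H$ is the free operation. (Equivalently: rooted trees, possibly empty, with edges colored by $\{1,\ldots,p\}$ and at most one incoming edge of each color at each vertex.)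 $|t|$ is the number of applications of $\lambda$ in $t$ and gives the grading. The counit $\varepsilon:H\to k$ is $1$ on $\emptyset$ and $0$ on all other trees. The coproduct $\Delta:H\to H\otimes H$ is the linear map determined by $\Delta(1)=1\otimes 1$ and $\Delta\circ\lambda=(\sigma_1\otimes\lambda+\lambda\otimes\sigma_2)\circ\tau\circ\Delta^{\otimes p}$, where $\tau:(H\otimes H)^{\otimes p}\to H^{\otimes p}\otimes H^{\otimes p}$ collects odd-position factors on the left and even-position factors on the right, and where the parameters $q_{1j}=\delta_{aj}$, $q_{2j}=\delta_{bj}$ give (via $\sigma_i(t_1,\ldots,t_p)=t_1\cdots t_p\prod_jq_{ij}^{|t_j|}$, $0^0=1$, with $\emptyset$ acting as unit) $\sigma_1(t_1,\ldots,t_p)=\big(\prod_{j\ne a}\varepsilon(t_j)\big)t_a$ and $\sigma_2(t_1,\ldots,t_p)=\big(\prod_{j\ne b}\varepsilon(t_j)\big)t_b$. This is a coassociative counital coproduct preserving the grading. The graded dual $H^*=\bigoplus_m(H_m)^*$ has basis $D_t$ dual to the trees $t$, and multiplication $*$ dual to $\Delta$, $(D_s*D_t)(u)=(D_s\otimes D_t)(\Delta(u))$, with unit $D_\emptyset$. Its augmentation is evaluation at $1=\emptyset$, and the augmentation ideal is spanned by the $D_t$ with $t\neq\emptyset$. *)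

(* Defs.v *)
From HB Require Import structures.
From mathcomp Require Import all_boot all_order all_algebra finmap.
From mathcomp Require Import monalg.
From mathcomp Require Import boolp functions.

Set Implicit Arguments.
Unset Strict Implicit.
Unset Printing Implicit Defensive.

Import GRing.Theory.
Local Open Scope ring_scope.

(* The vector space with basis K is {malg k[K]}, with << t >> the basis vector
   of t : K and x@_t the coefficient of t in x. Accordingly, for free modules,
   V (x) W and V^(x)p are the free modules on pairs and on p-families of basis
   elements. *)

HB.lock Definition linext (k : fieldType) (K : choiceType) (V : lmodType k)
    (f : K -> V) (x : {malg k[K]}) : V :=
  \sum_(t <- msupp x) x@_t *: f t.

Section FreeModule.
Variable k : fieldType.

Section LinExt.
Variables (K : choiceType) (V : lmodType k) (f : K -> V).

Local Notation linext := (linext f).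

Lemma linextE (x : {malg k[K]}) : linext x = \sum_(t <- msupp x) x@_t *: f t.
Proof. by rewrite linext.unlock. Qed.

Lemma linextw (d : {fset K}) (x : {malg k[K]}) :
  (msupp x `<=` d)%fset -> linext x = \sum_(t <- d) x@_t *: f t.
Proof.
move=> le_d; rewrite linextE (big_fset_incl _ le_d) //= => t _.
by move=> /mcoeff_outdom ->; rewrite scale0r.
Qed.

Lemma linext_is_linear : linear linext.
Proof.
move=> c x y.
pose d := (msupp x `|` msupp y)%fset.
have lx : (msupp x `<=` d)%fset by exact: fsubsetUl.
have ly : (msupp y `<=` d)%fset by exact: fsubsetUr.
have lxy : (msupp (c *: x + y) `<=` d)%fset.
  apply: fsubset_trans (msuppD_le _ _) _.
  by rewrite fsubUset ly andbT (fsubset_trans (msuppZ_le _ _) lx).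
rewrite (linextw lxy) (linextw lx) (linextw ly) scaler_sumr -big_split /=.
by apply: eq_bigr => t _; rewrite mcoeffD mcoeffZ scalerDl scalerA.
Qed.

HB.instance Definition _ :=
  GRing.isLinear.Build k {malg k[K]} V *:%R linext linext_is_linear.

Lemma linextU (t : K) : linext << t >> = f t.
Proof. by rewrite (linextw msuppU_le) big_seq_fset1 mcoeffUU scale1r. Qed.

End LinExt.

Definition tens (K L : choiceType) (x : {malg k[K]}) (y : {malg k[L]}) :
    {malg k[(K * L)%type]} :=
  linext (fun s => linext (fun t => << (s, t) >>) y) x.

Definition tmap (K L K' L' : choiceType) (F : {malg k[K]} -> {malg k[K']})
    (G : {malg k[L]} -> {malg k[L']}) :
    {malg k[(K * L)%type]} -> {malg k[(K' * L')%type]} :=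
  linext (fun st => tens (F << st.1 >>) (G << st.2 >>)).

HB.instance Definition _ (K L K' L' : choiceType) F G :=
  GRing.Linear.copy (@tmap K L K' L' F G) (linext _).

(* v_1 (x) ... (x) v_p; see mtensE for its coefficients. *)
Definition mtens (p : nat) (K : choiceType) (v : 'I_p -> {malg k[K]}) :
    {malg k[{ffun 'I_p -> K}]} :=
  let S := (\big[fsetU/fset0]_i msupp (v i))%fset in
  let D := [fset ([ffun i => val (g i)] : {ffun 'I_p -> K})
           | g : {ffun 'I_p -> S} in predT]%fset in
  [malg f in D => \prod_i (v i)@_(f i)].

Lemma mtensE (p : nat) (K : choiceType) (v : 'I_p -> {malg k[K]}) f :
  (mtens v)@_f = \prod_i (v i)@_(f i).
Proof.
rewrite /mtens mcoeffE; case: ifPn => // nf; apply/esym/eqP.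
apply: contraNT nf => /prodf_neq0 nz.
have fS i : f i \in (\big[fsetU/fset0]_i msupp (v i))%fset.
  have := nz i isT; rewrite mcoeff_neq0; apply/fsubsetP.
  by rewrite (bigD1 i) //= fsubsetUl.
apply/imfsetP; exists [ffun i => FSetSub (fS i)] => //=.
by apply/ffunP => i; rewrite !ffunE.
Qed.

Definition tpow (p : nat) (K L : choiceType) (F : {malg k[K]} -> {malg k[L]}) :
    {malg k[{ffun 'I_p -> K}]} -> {malg k[{ffun 'I_p -> L}]} :=
  linext (fun f : {ffun 'I_p -> K} => mtens (fun i => F << f i >>)).

HB.instance Definition _ (p : nat) (K L : choiceType) F :=
  GRing.Linear.copy (@tpow p K L F) (linext _).

End FreeModule.

Inductive tree (p : nat) := Empty | Lam of {ffun 'I_p -> tree p}.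

Arguments Empty {p}.

Section Tree.
Variable p : nat.

Lemma tree_finfun_ind (P : tree p -> Prop) :
  P Empty ->
  (forall f : {ffun 'I_p -> tree p}, (forall i, P (f i)) -> P (Lam f)) ->
  forall t, P t.
Proof.
move=> PE PL; fix IH 1 => -[|f]; first exact: PE.
by apply: PL => i; apply: IH.
Qed.

Fixpoint tree_encode (t : tree p) : GenTree.tree unit :=
  if t is Lam f then GenTree.Node 0 [seq tree_encode (f i) | i <- enum 'I_p]
  else GenTree.Leaf tt.

Fixpoint tree_decode (g : GenTree.tree unit) : tree p :=
  if g is GenTree.Node _ l
  then Lam [ffun i : 'I_p => nth Empty [seq tree_decode h | h <- l] i]
  else Empty.

Lemma tree_encodeK : cancel tree_encode tree_decode.
Proof.
elim/tree_finfun_ind => [//|f IH] /=; congr Lam; apply/ffunP => i.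
rewrite ffunE -map_comp (nth_map i) ?size_enum_ord //=.
by rewrite nth_ord_enum IH.
Qed.

HB.instance Definition _ := Countable.copy (tree p) (can_type tree_encodeK).

Fixpoint tdeg (t : tree p) : nat :=
  if t is Lam f then (\sum_i tdeg (f i)).+1 else 0.

End Tree.

Section Coproduct.
Variables (k : fieldType) (p : nat).

Notation H := {malg k[tree p]}.
Notation HH := {malg k[(tree p * tree p)%type]}.
Notation Hp := {malg k[{ffun 'I_p -> tree p}]}.
Notation HpHp :=
  {malg k[({ffun 'I_p -> tree p} * {ffun 'I_p -> tree p})%type]}.
Notation HHp := {malg k[{ffun 'I_p -> (tree p * tree p)%type}]}.

Definition lam : Hp -> H := linext (fun f : {ffun 'I_p -> tree p} => << Lam f >>).

Definition counit (x : H) : k := x@_Empty.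

(* sigma c is sigma_i for the parameters q_ij = delta_cj: the factor
   prod_j q_ij ^ |t_j| kills every (t_1, ..., t_p) having a nonempty t_j with
   j <> c, and leaves t_c otherwise. *)
Definition sigma (c : 'I_p) : Hp -> H :=
  linext (fun f : {ffun 'I_p -> tree p} =>
    (\prod_(j | j != c) counit << f j >>) *: << f c >>).

Definition tau : HHp -> HpHp :=
  linext (fun g : {ffun 'I_p -> (tree p * tree p)%type} =>
    << ([ffun i => (g i).1], [ffun i => (g i).2]) >>).

HB.instance Definition _ := GRing.Linear.copy lam (linext _).
HB.instance Definition _ := GRing.Linear.copy tau (linext _).

Variables a b : 'I_p.

Definition Delta_step (x : HHp) : HH :=
  tmap (sigma a) lam (tau x) + tmap lam (sigma b) (tau x).

Fixpoint Delta_tree (t : tree p) : HH :=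
  if t is Lam f then Delta_step (mtens (fun i => Delta_tree (f i)))
  else << (Empty, Empty) >>.

Definition Delta : H -> HH := linext Delta_tree.

HB.instance Definition _ := GRing.Linear.copy Delta (linext _).

Lemma Delta_Empty : Delta << Empty >> = << (Empty, Empty) >>.
Proof. by rewrite /Delta linextU. Qed.

Lemma Delta_step_is_linear : linear Delta_step.
Proof.
move=> c x y; rewrite /Delta_step !linearP /=.
by rewrite scalerDr addrACA.
Qed.

HB.instance Definition _ :=
  GRing.isLinear.Build k HHp HH *:%R Delta_step Delta_step_is_linear.

Lemma Delta_lam (x : Hp) : Delta (lam x) = Delta_step (tpow Delta x).
Proof.
rewrite /lam /tpow !linextE !raddf_sum /=; apply: eq_bigr => f _.
rewrite !linearZ /= {1}/Delta linextU /=; congr (_ *: Delta_step (mtens _)).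
by apply: funext => i; rewrite /Delta linextU.
Qed.

Lemma linext_supp (K L : choiceType) (f : K -> {malg k[L]}) x l :
  (linext f x)@_l != 0 -> exists2 t, x@_t != 0 & (f t)@_l != 0.
Proof.
rewrite linextE raddf_sum /=; case: (boolP (has (fun t =>
  (x@_t *: f t)@_l != 0) (msupp x))) => [/hasP[t tx]|/hasPn nz].
  rewrite mcoeffZ mulf_eq0 negb_or => /andP[xt ft] _.
  by exists t.
rewrite big_seq big1 ?eqxx // => t /nz; rewrite negbK => /eqP; exact.
Qed.

Lemma basis_supp (K : choiceType) (t u : K) :
  (<< t >> : {malg k[K]})@_u != 0 -> t = u.
Proof. by rewrite mcoeffU; have [//|_] := eqVneq t u; rewrite mulr0n eqxx. Qed.

Lemma tmap_supp (K L K' L' : choiceType) (F : {malg k[K]} -> {malg k[K']})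
    (G : {malg k[L]} -> {malg k[L']}) z u v :
  (tmap F G z)@_(u, v) != 0 -> exists s t,
    [/\ z@_(s, t) != 0, (F << s >>)@_u != 0 & (G << t >>)@_v != 0].
Proof.
case/linext_supp => -[s t] zst; case/linext_supp => u' Fu.
by case/linext_supp => v' Gv /basis_supp[<- <-]; exists s, t.
Qed.

Lemma lam_supp (f : {ffun 'I_p -> tree p}) u : (lam << f >>)@_u != 0 -> u = Lam f.
Proof. by rewrite /lam linextU => /basis_supp. Qed.

Lemma sigma_supp c (f : {ffun 'I_p -> tree p}) u :
  (sigma c << f >>)@_u != 0 -> (\sum_i tdeg (f i) = tdeg u)%N.
Proof.
rewrite /sigma linextU mcoeffZ mulf_eq0 negb_or => /andP[/prodf_neq0 nz].
move=> /basis_supp <-; rewrite (bigD1 c) //= big1 ?addn0 // => j /nz.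
by rewrite /counit => /basis_supp ->.
Qed.

Lemma Delta_tree_graded t u v :
  (Delta_tree t)@_(u, v) != 0 -> (tdeg u + tdeg v = tdeg t)%N.
Proof.
elim/tree_finfun_ind: t u v => [|f IH] u v /=; first by case/basis_supp => <- <-.
have tauP x s t : (tau x)@_(s, t) != 0 -> (exists2 g, x@_g != 0
    & forall i, g i = (s i, t i)).
  case/linext_supp => g xg /basis_supp[<- <-]; exists g => // i.
  by rewrite !ffunE; case: (g i).
have mE s t : (tau (mtens (fun i => Delta_tree (f i))))@_(s, t) != 0 ->
    (\sum_i tdeg (s i) + \sum_i tdeg (t i) = \sum_i tdeg (f i))%N.
  case/tauP => g; rewrite mtensE => /prodf_neq0 nz gE.
  rewrite -big_split; apply: eq_bigr => i _; apply: IH.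
  by have := nz i isT; rewrite gE.
rewrite /Delta_step; move: (tau _) mE => z mE; rewrite mcoeffD.
have [->|n1 _] := eqVneq (tmap (sigma a) lam z)@_(u, v) 0.
  rewrite add0r => /tmap_supp[s [t [/mE <- /lam_supp -> /sigma_supp <-]]] //=.
have [s [t [/mE <- /sigma_supp <- /lam_supp ->]]] := tmap_supp n1.
by rewrite addnS.
Qed.

End Coproduct.

Section GradedDual.
Variables (k : fieldType) (p : nat).

Notation H := {malg k[tree p]}.

Definition homogeneous (m : nat) (x : H) : bool :=
  all (fun t => tdeg t == m) (msupp x).

Lemma homogeneousU (t : tree p) : homogeneous (tdeg t) << t >>.
Proof.
by apply/allP => u; rewrite -mcoeff_neq0 => /basis_supp ->.
Qed.

(* An element of the direct sum of the (H_m)^* is a linear form on H that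
   vanishes on H_m for all but finitely many m. *)
Definition gdual_pred : pred (H -> k^o) := fun phi =>
  `[< linear phi /\
      exists N, forall m x, (N <= m)%N -> homogeneous m x -> phi x = 0 >].

Lemma gdual_submod_closed : submod_closed gdual_pred.
Proof.
split=> [|c f g /asboolP[lf [M fM]] /asboolP[lg [N gN]]]; apply/asboolP.
  by split=> [c x y|]; [rewrite scaler0 addr0|exists 0%N].
split=> [d x y|].
  rewrite !fctE /= lf lg scalerDr [in RHS]scalerDr !scalerA [c * d]mulrC.
  by rewrite addrACA.
exists (maxn M N) => m x; rewrite geq_max => /andP[Mm Nm] hx.
by rewrite !fctE /= (fM m) // (gN m) // scaler0 addr0.
Qed.

HB.instance Definition _ :=
  GRing.isSubmodClosed.Build k (H -> k^o) gdual_pred gdual_submod_closed.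

Record gdual := GDual { gdual_val :> H -> k^o; _ : gdual_val \in gdual_pred }.

HB.instance Definition _ := [isSub for gdual_val].
HB.instance Definition _ := [Choice of gdual by <:].
HB.instance Definition _ := [SubChoice_isSubLmodule of gdual by <:].

(* Evaluation at 1. *)
Definition augmentation (x : gdual) : k := x << Empty >>.

Definition augideal_pred : pred gdual := fun x => augmentation x == 0.

Lemma augideal_submod_closed : submod_closed augideal_pred.
Proof.
split=> [|c x y]; rewrite /in_mem /= /augideal_pred /augmentation //=.
by move=> /eqP xE /eqP yE; rewrite !fctE /= xE yE scaler0 addr0.
Qed.

HB.instance Definition _ :=
  GRing.isSubmodClosed.Build k gdual augideal_pred augideal_submod_closed.

Record augideal :=
  AugIdeal { augideal_val :> gdual; _ : augideal_val \in augideal_pred }.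

HB.instance Definition _ := [isSub for augideal_val].
HB.instance Definition _ := [Choice of augideal by <:].
HB.instance Definition _ := [SubChoice_isSubLmodule of augideal by <:].

(* x lies in (H_m)^*. *)
Definition has_degree (m : nat) (x : augideal) : Prop :=
  forall n h, n != m -> homogeneous n h -> x h = 0.

Variables a b : 'I_p.

(* h |-> (phi (x) psi) (Delta h) *)
Definition conv (phi psi : H -> k^o) (h : H) : k^o :=
  linext (fun st => phi << st.1 >> * psi << st.2 >> : k^o) (Delta a b h).

Lemma conv_gdual (x y : gdual) : conv x y \in gdual_pred.
Proof.
case: x y => [f /asboolP[lf [M fM]]] [g /asboolP[lg [N gN]]] /=.
apply/asboolP; split=> [c u v|]; first by rewrite /conv /Delta !linearP.
exists (M + N)%N => m h le_m /allP hm.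
rewrite /conv linextE big_seq big1 // => -[s t]; rewrite -mcoeff_neq0 => nz.
have {nz} st : (tdeg s + tdeg t)%N = m.
  have [r rh /Delta_tree_graded ->] := linext_supp nz.
  by apply/eqP/hm; rewrite -mcoeff_neq0.
have [Ms|sM] := leqP M (tdeg s).
  by rewrite /= (fM _ _ Ms (homogeneousU s)) mul0r scaler0.
have Nt : (N <= tdeg t)%N.
  by rewrite -(leq_add2l (tdeg s)) st (leq_trans _ le_m) // leq_add2r ltnW.
by rewrite /= (gN _ _ Nt (homogeneousU t)) mulr0 scaler0.
Qed.

Definition gmul (x y : gdual) : gdual := GDual (conv_gdual x y).

End GradedDual.

Record dendriform (k : fieldType) (V : lmodType k) := Dendriform {
  dprec : {bilinear V -> V -> V};
  dsucc : {bilinear V -> V -> V};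
  dprec_dprec : forall x y z : V,
    dprec (dprec x y) z = dprec x (dprec y z) + dprec x (dsucc y z);
  dsucc_dprec : forall x y z : V,
    dsucc x (dprec y z) = dprec (dsucc x y) z;
  dsucc_dsucc : forall x y z : V,
    dsucc x (dsucc y z) = dsucc (dprec x y) z + dsucc (dsucc x y) z
}.

Definition dassoc (k : fieldType) (V : lmodType k) (D : dendriform V)
  (x y : V) : V := dprec D x y + dsucc D x y.

Definition graded_dendriform (k : fieldType) (V : lmodType k)
    (deg : nat -> V -> Prop) (D : dendriform V) : Prop :=
  forall m m' x y, deg m x -> deg m' y ->
    deg (m + m')%N (dprec D x y) /\ deg (m + m')%N (dsucc D x y).

(* Main.v *)
From HB Require Import structures.
Require Import Defs.
From mathcomp Require Import all_boot all_order all_algebra finmap.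
From mathcomp Require Import monalg.
From mathcomp Require Import boolp functions.

Set Implicit Arguments.
Unset Strict Implicit.
Unset Printing Implicit Defensive.

Import GRing.Theory.
Local Open Scope ring_scope.

(** Write x in H^* through its coordinates, the functions t |-> x(t) on trees,
and split the coproduct of a tree lambda(f), f = (t_1, ..., t_p), according to
the two summands that define it.  In the first one sigma_1 keeps only the terms
of Delta(t_1) (x) ... (x) Delta(t_p) whose left factors in the positions j <> a
are the empty tree; by the counit property those positions contribute t_j on the
right, so that
  Delta_succ(lambda(f)) = sum t_a' (x) lambda(t_1, ..., t_a'', ..., t_p),
and symmetrically
  Delta_prec(lambda(f)) = sum lambda(t_1, ..., t_b', ..., t_p) (x) t_b''.
This is [Delta_treeE], which rests on [Delta_tree_counit].

Dually, write lambda(s_1, ..., s_p) for the form with value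
s_1(t_1) ... s_p(t_p) at lambda(t_1, ..., t_p) and 0 at the empty tree. Then
  y succ lambda(s) = lambda(s_1, ..., y * s_a, ..., s_p),
  lambda(s) prec z = lambda(s_1, ..., s_b * z, ..., s_p),
and * is the sum of the two products away from the empty tree.  Each dendriform
identity at lambda(f) thus says that two multiplications in one position may be
rebracketed, which is associativity of * at t_a or t_b; the one exception is
y succ (lambda(s) prec z) with a <> b, where the two multiplications take place
in different positions and commute ([tform_exchange]).

Associativity of * is obtained at the same time, by induction on trees: the
dendriform identities at lambda(f) need it only at the t_j
([tprec_tprec_Lam], [tsucc_tprec_Lam], [tsucc_tsucc_Lam]), and adding up the
three of them gives it at lambda(f) ([tconvA]).

The half coproducts preserve the grading, so the dual products map pairs of
forms vanishing in large degrees to such forms and add degrees; they vanish on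
the empty tree, where the product of two elements of the augmentation ideal
vanishes as well. *)

(** * Linear extension of functions on a basis *)

Section LinearExtension.
Variable k : fieldType.

Lemma linear_linext (K : choiceType) (V W : lmodType k) (L : {linear V -> W})
    (h : K -> V) (x : {malg k[K]}) :
  L (linext h x) = linext (L \o h) x.
Proof.
by rewrite !linextE raddf_sum; apply: eq_bigr => t _; rewrite /= linearZ.
Qed.

Lemma eq_linext_supp (K : choiceType) (V : lmodType k) (f g : K -> V)
    (x : {malg k[K]}) :
  (forall t, x@_t != 0 -> f t = g t) -> linext f x = linext g x.
Proof.
move=> fg; rewrite !linextE big_seq [RHS]big_seq; apply: eq_bigr => t.
by rewrite -mcoeff_neq0 => /fg ->.
Qed.

Lemma linext_indicator (K : choiceType) (x : {malg k[K]}) t :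
  linext (fun s => (s == t)%:R : k^o) x = x@_t.
Proof.
rewrite linextE; have [tx|tx] := boolP (t \in msupp x).
  rewrite (bigD1_seq t) ?fset_uniq //= eqxx big1 => [|s /negPf ->].
    by rewrite addr0 -[LHS]/(_ * _) mulr1.
  by rewrite scaler0.
rewrite (mcoeff_outdom tx) big_seq big1 // => s sx.
by case: eqVneq sx tx => [-> ->|]; rewrite ?scaler0.
Qed.

Lemma mcoeff_linext (K L : choiceType) (h : K -> L) (x : {malg k[K]}) l :
  (linext (fun s => << h s >>) x)@_l = linext (fun s => (h s == l)%:R : k^o) x.
Proof.
rewrite !linextE raddf_sum; apply: eq_bigr => s _.
by rewrite /= mcoeffZ mcoeffU.
Qed.

Lemma linext_single (K : choiceType) (theta : K -> k) (x : {malg k[K]}) t c :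
  (forall s, x@_s != 0 -> theta s = c * (s == t)%:R) ->
  linext (theta : K -> k^o) x = c * x@_t.
Proof.
move=> th; rewrite -linext_indicator -[RHS]/(c *: (_ : k^o)).
by rewrite linear_linext; apply: (@eq_linext_supp _ k^o) => s /th.
Qed.

(** A linear map is determined by its values on the basis. *)
Lemma linear_malgE (K : choiceType) (V : lmodType k) (L : {malg k[K]} -> V) :
  linear L -> forall x, L x = linext (fun t => L << t >>) x.
Proof.
move=> linL x; pose Llin := GRing.isLinear.Build k {malg k[K]} V *:%R L linL.
pose LL : {linear {malg k[K]} -> V} := HB.pack L Llin.
have {1}-> : x = linext (fun t => << t >> : {malg k[K]}) x.
  by apply/malgP => t; rewrite mcoeff_linext linext_indicator.
exact: (linear_linext LL).
Qed.

End LinearExtension.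

(** * Changing one entry of a family *)

Section Update.
Variables (p : nat) (T : eqType).

Definition ffun_upd (c : 'I_p) (f : {ffun 'I_p -> T}) (u : T) :
    {ffun 'I_p -> T} :=
  [ffun j => if j == c then u else f j].

Lemma ffun_upd_same c f u : ffun_upd c f u c = u.
Proof. by rewrite ffunE eqxx. Qed.

Lemma ffun_upd_other c f u j : j != c -> ffun_upd c f u j = f j.
Proof. by rewrite ffunE => /negPf ->. Qed.

Lemma ffun_upd_id c f : ffun_upd c f (f c) = f.
Proof. by apply/ffunP => j; rewrite ffunE; case: eqP => // ->. Qed.

Lemma ffun_upd_inj c f : injective (ffun_upd c f).
Proof.
by move=> u v /(congr1 (fun g : {ffun _} => g c)); rewrite !ffun_upd_same.
Qed.

Lemma ffun_upd_upd c f u v : ffun_upd c (ffun_upd c f u) v = ffun_upd c f v.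
Proof. by apply/ffunP => j; rewrite !ffunE; case: eqP. Qed.

Lemma ffun_updC c d f u v : c != d ->
  ffun_upd c (ffun_upd d f u) v = ffun_upd d (ffun_upd c f v) u.
Proof.
move=> cd; apply/ffunP => j; rewrite !ffunE; case: (eqVneq j c) => // ->.
by rewrite (negPf cd).
Qed.

End Update.

(** * The two halves of the coproduct *)

Section HalfCoproducts.
Variables (k : fieldType) (p : nat).

(** A linear map Theta that sees the factors v_j with j <> c only through their
e_j-components, which have coefficient 1, cannot distinguish
v_1 (x) ... (x) v_p from e_1 (x) ... (x) v_c (x) ... (x) e_p: the coefficients
of these two tensors agree on every basis family where Theta does not vanish.
This turns a counit property in all positions but one into a computation of
[Delta_step]. *)
Lemma linext_mtens_concentrated (K : choiceType) (V : lmodType k) (c : 'I_p)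
    (v : 'I_p -> {malg k[K]}) (e : {ffun 'I_p -> K})
    (Theta : {ffun 'I_p -> K} -> V) :
  (forall g, Theta g != 0 ->
    forall j, j != c -> (v j)@_(g j) = (e j == g j)%:R) ->
  linext Theta (mtens v) = linext (fun x => Theta (ffun_upd c e x)) (v c).
Proof.
move=> He; pose w := linext (fun x => << ffun_upd c e x >>) (v c) : {malg k[_]}.
have -> : linext (fun x => Theta (ffun_upd c e x)) (v c) = linext Theta w.
  by rewrite /w linear_linext; apply: eq_linext_supp => x _ /=; rewrite linextU.
apply/eqP; rewrite -subr_eq0 -linearB /= linextE big1 // => g _.
have [->|Tg] := eqVneq (Theta g) 0; first by rewrite scaler0.
rewrite mcoeffB mtensE (bigD1 c) //=.
rewrite (eq_bigr (fun j => (e j == g j)%:R)) => [|j jc]; last by rewrite (He g).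
suff -> : w@_g = (v c)@_(g c) * \prod_(j | j != c) (e j == g j)%:R.
  by rewrite subrr scale0r.
have [/forall_inP eg|] := boolP [forall (j | j != c), e j == g j].
  rewrite big1 => [|j jc]; last by rewrite eg.
  have <- : ffun_upd c e (g c) = g.
    by apply/ffunP => j; rewrite ffunE; case: eqVneq => [->//|/eg/eqP].
  rewrite ffun_upd_same mulr1 /w mcoeff_linext -linext_indicator.
  apply: (@eq_linext_supp k _ k^o) => x _.
  by rewrite (inj_eq (@ffun_upd_inj _ _ c e)).
rewrite negb_forall_in => /exists_inP[j jc ej].
rewrite (bigD1 j) //= (negPf ej) mul0r mulr0 /w mcoeff_linext.
rewrite linextE big1 // => x _; case: eqP => [xg|]; last by rewrite scaler0.
by rewrite -xg ffun_upd_other ?eqxx in ej.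
Qed.

Variables a b : 'I_p.

Local Notation HH := {malg k[(tree p * tree p)%type]}.
Local Notation Delta_tree := (@Delta_tree k p a b).

(** The half of the coproduct dual to succ: the left factor of the coproduct of
a tree is cut off from its a-th branch and the root stays on the right. On the
empty tree, where Delta is not split, the value 0 makes the dual product take
its values in the augmentation ideal. *)
Definition Dsucc (t : tree p) : HH :=
  if t is Lam f
  then linext (fun st => << (st.1, Lam (ffun_upd a f st.2)) >>)
         (Delta_tree (f a))
  else 0.

(** The half dual to prec: the right factor is cut off from the b-th branch. *)
Definition Dprec (t : tree p) : HH :=
  if t is Lam f
  then linext (fun st => << (Lam (ffun_upd b f st.1), st.2) >>)
         (Delta_tree (f b))
  else 0.

(** In the positions j <> a, sigma_1 selects the components of Delta(f_j) with
empty left factor, and the left counit property at f_j says that their sum is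
Empty (x) f_j. *)
Lemma Dsucc_Lam (f : {ffun 'I_p -> tree p}) :
  (forall i r, (Delta_tree (f i))@_(Empty, r) = (f i == r)%:R) ->
  tmap (sigma a) (@lam k p) (tau (mtens (fun i => Delta_tree (f i)))) =
  Dsucc (Lam f).
Proof.
move=> cu; rewrite /tau linear_linext [RHS]/=.
rewrite (@linext_mtens_concentrated _ _ a _ [ffun i => (Empty, f i)]) => [|g].
  apply: eq_linext_supp => -[s r] _ /=.
  rewrite /tmap linextU /= /sigma /lam !linextU /tens linearZ /= !linextU.
  rewrite big1 => [|j ja]; last first.
    by rewrite /counit !ffunE (negPf ja) /= mcoeffUU.
  rewrite scale1r !ffunE eqxx /=; congr << (_, Lam _) >>.
  by apply/ffunP => j; rewrite !ffunE; case: eqP.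
rewrite /= /tmap linextU /= /sigma linextU /tens linearZ /= scaler_eq0 negb_or.
case/andP => /prodf_neq0 nz _ j ja; have := nz j ja.
rewrite /counit !ffunE => /basis_supp; case: (g j) => s r /= ->.
by rewrite cu xpair_eqE eqxx.
Qed.

Lemma Dprec_Lam (f : {ffun 'I_p -> tree p}) :
  (forall i r, (Delta_tree (f i))@_(r, Empty) = (f i == r)%:R) ->
  tmap (@lam k p) (sigma b) (tau (mtens (fun i => Delta_tree (f i)))) =
  Dprec (Lam f).
Proof.
move=> cu; rewrite /tau linear_linext [RHS]/=.
rewrite (@linext_mtens_concentrated _ _ b _ [ffun i => (f i, Empty)]) => [|g].
  apply: eq_linext_supp => -[s r] _ /=.
  rewrite /tmap linextU /= /sigma /lam !linextU /tens !linextU linearZ /=.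
  rewrite !linextU.
  rewrite big1 => [|j ja]; last first.
    by rewrite /counit !ffunE (negPf ja) /= mcoeffUU.
  rewrite scale1r !ffunE eqxx /=; congr << (Lam _, _) >>.
  by apply/ffunP => j; rewrite !ffunE; case: eqP.
rewrite /= /tmap linextU /= /sigma linextU /lam linextU /tens linextU.
rewrite linearZ /= scaler_eq0 negb_or.
case/andP => /prodf_neq0 nz _ j ja; have := nz j ja.
rewrite /counit !ffunE => /basis_supp; case: (g j) => r s /= ->.
by rewrite cu xpair_eqE eqxx andbT.
Qed.

(** Both counit properties, (eps (x) id) Delta = id = (id (x) eps) Delta, on
coefficients. They go together, because the expansion of Delta(lambda(f)) into
its two halves uses both of them at the branches. Only the succ half has terms
with empty left factor, only the prec half has terms with empty right factor. *)
Lemma Delta_tree_counit t :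
  (forall r, (Delta_tree t)@_(Empty, r) = (t == r)%:R) /\
  (forall r, (Delta_tree t)@_(r, Empty) = (t == r)%:R).
Proof.
elim/tree_finfun_ind: t => [|f IH].
  by split=> r; rewrite /= mcoeffU xpair_eqE eqxx ?andbT.
have cul i := (IH i).1; have cur i := (IH i).2.
rewrite /= /Delta_step Dsucc_Lam // Dprec_Lam //.
split=> r; rewrite mcoeffD /= !mcoeff_linext.
  rewrite [X in _ + X]linextE [X in _ + X]big1 ?addr0 => [|s _]; last first.
    by rewrite xpair_eqE scaler0.
  rewrite (@linext_single k _ _ _ (Empty, f a) (Lam f == r)%:R) => [|[u v]].
    by rewrite cul eqxx mulr1.
  rewrite /= !xpair_eqE.
  case: (eqVneq u Empty) => [->|_ _]; last by rewrite mulr0.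
  rewrite cul; case: (eqVneq (f a) v) => [<- _|]; last by rewrite eqxx.
  by rewrite ffun_upd_id mulr1.
rewrite [X in X + _]linextE [X in X + _]big1 ?add0r => [|s _]; last first.
  by rewrite xpair_eqE andbF scaler0.
rewrite (@linext_single k _ _ _ (f b, Empty) (Lam f == r)%:R) => [|[u v]].
  by rewrite cur eqxx mulr1.
rewrite /= !xpair_eqE; case: (eqVneq v Empty) => [->|_ _].
  rewrite cur; case: (eqVneq (f b) u) => [<- _|]; last by rewrite eqxx.
  by rewrite ffun_upd_id andbT mulr1.
by rewrite !andbF mulr0.
Qed.

Lemma Delta_treeE f : Delta_tree (Lam f) = Dsucc (Lam f) + Dprec (Lam f).
Proof.
rewrite {1}/Defs.Delta_tree -/(Delta_tree) /Delta_step Dsucc_Lam ?Dprec_Lam //.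
  by move=> i r; case: (Delta_tree_counit (f i)).
by move=> i r; case: (Delta_tree_counit (f i)).
Qed.

End HalfCoproducts.

(** * Tensor products of linear forms *)

Section TensorForm.
Variables (k : fieldType) (K L : choiceType).
Implicit Types (phi : K -> k) (psi : L -> k) (z : {malg k[(K * L)%type]}).

(** The linear form phi (x) psi, with phi and psi given by their values on the
bases. *)
Definition tform phi psi : {malg k[(K * L)%type]} -> k^o :=
  linext (fun st => phi st.1 * psi st.2 : k^o).

HB.instance Definition _ phi psi :=
  GRing.Linear.copy (tform phi psi) (linext _).

Lemma tformE phi psi z :
  tform phi psi z = \sum_(st <- msupp z) z@_st * (phi st.1 * psi st.2).
Proof. exact: linextE. Qed.

Lemma tform_linext (J : choiceType) phi psi (h : J -> K * L) (x : {malg k[J]}) :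
  tform phi psi (linext (fun s => << h s >>) x) =
  linext (fun s => phi (h s).1 * psi (h s).2 : k^o) x.
Proof.
rewrite linear_linext; apply: (@eq_linext_supp k _ k^o) => s _ /=.
exact: linextU.
Qed.

Lemma tform_linear_l psi z c phi1 phi2 :
  tform (fun t => c * phi1 t + phi2 t) psi z =
  c * tform phi1 psi z + tform phi2 psi z.
Proof.
rewrite !tformE mulr_sumr -big_split /=; apply: eq_bigr => st _.
by rewrite mulrDl mulrDr -!mulrA; congr (_ + _); rewrite mulrCA.
Qed.

Lemma tform_linear_r phi z c psi1 psi2 :
  tform phi (fun t => c * psi1 t + psi2 t) z =
  c * tform phi psi1 z + tform phi psi2 z.
Proof.
rewrite !tformE mulr_sumr -big_split /=; apply: eq_bigr => st _.
by rewrite !mulrDr; congr (_ + _); rewrite !(mulrCA _ c).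
Qed.

Lemma tform_addl psi z phi1 phi2 :
  tform (fun t => phi1 t + phi2 t) psi z = tform phi1 psi z + tform phi2 psi z.
Proof.
rewrite -[X in _ = X + _]mul1r -tform_linear_l.
by congr (tform _ _ _); apply: funext => t; rewrite mul1r.
Qed.

Lemma tform_addr phi z psi1 psi2 :
  tform phi (fun t => psi1 t + psi2 t) z = tform phi psi1 z + tform phi psi2 z.
Proof.
rewrite -[X in _ = X + _]mul1r -tform_linear_r.
by congr (tform _ _ _); apply: funext => t; rewrite mul1r.
Qed.

Lemma tform_neq0 phi psi z : tform phi psi z != 0 ->
  exists u v, [/\ z@_(u, v) != 0, phi u != 0 & psi v != 0].
Proof.
rewrite tformE => nz.
have [/hasP[[u v] uvz]|/hasPn nh] :=
  boolP (has (fun st => phi st.1 * psi st.2 != 0) (msupp z)).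
  by rewrite mulf_eq0 negb_or => /andP[pu pv]; exists u, v; rewrite mcoeff_neq0.
case/eqP: nz; rewrite big_seq big1 // => st /nh.
by rewrite negbK => /eqP ->; rewrite mulr0.
Qed.

End TensorForm.

(** Both sides are the value of phi (x) psi (x) chi at z (x) w, where psi is a
form in the two inner tensor factors. *)
Lemma tform_exchange (k : fieldType) (K L M N : choiceType) (phi : K -> k)
    (psi : M -> L -> k) (chi : N -> k) (z : {malg k[(K * L)%type]})
    (w : {malg k[(M * N)%type]}) :
  tform (fun u => tform phi (psi u) z : k) chi w =
  tform phi (fun v => tform (psi^~ v) chi w : k) z.
Proof.
rewrite tformE [RHS]tformE.
under eq_bigr => st _ do rewrite tformE mulr_suml mulr_sumr.
rewrite exchange_big; apply: eq_bigr => uv _.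
rewrite tformE mulr_sumr mulr_sumr; apply: eq_bigr => st _ /=.
rewrite -!mulrA mulrCA; congr (_ * _).
by rewrite mulrCA; congr (_ * _); rewrite mulrCA.
Qed.

(** * Convolution on trees and the dendriform identities *)

Section Convolution.
Variables (k : fieldType) (p : nat).
Implicit Types (phi psi chi : tree p -> k) (f : {ffun 'I_p -> tree p}).

Variables a b : 'I_p.

Local Notation Delta_tree := (@Delta_tree k p a b).
Local Notation Dsucc := (@Dsucc k p a b).
Local Notation Dprec := (@Dprec k p a b).

Lemma tform_Dsucc phi psi f :
  tform phi psi (Dsucc (Lam f)) =
  tform phi (fun u => psi (Lam (ffun_upd a f u))) (Delta_tree (f a)).
Proof. exact: tform_linext. Qed.

Lemma tform_Dprec phi psi f :
  tform phi psi (Dprec (Lam f)) =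
  tform (fun u => phi (Lam (ffun_upd b f u))) psi (Delta_tree (f b)).
Proof. exact: tform_linext. Qed.

Definition tconv phi psi t := tform phi psi (Delta_tree t).
Definition tsucc phi psi t := tform phi psi (Dsucc t).
Definition tprec phi psi t := tform phi psi (Dprec t).

Lemma tconvE phi psi f :
  tconv phi psi (Lam f) = tsucc phi psi (Lam f) + tprec phi psi (Lam f).
Proof. by rewrite /tconv Delta_treeE linearD. Qed.

(** Quantifying over all three forms at a fixed tree is what the induction in
[tconvA] needs: at a branch of lambda(f) one of the forms is replaced by
u |-> psi(lambda(f with u in one position)). *)
Definition tassoc t := forall phi psi chi,
  tconv (tconv phi psi) chi t = tconv phi (tconv psi chi) t.

(** The forms phi and chi act on the a-th and on the b-th branch. If a = b this
is associativity at that branch, otherwise the two actions commute. *)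
Lemma tsucc_tprec_Lam phi psi chi f : tassoc (f a) ->
  tsucc phi (tprec psi chi) (Lam f) = tprec (tsucc phi psi) chi (Lam f).
Proof.
move=> fa; rewrite /tsucc /tprec tform_Dsucc tform_Dprec.
have [ab|ab] := eqVneq a b.
  (* the coproduct depends on b too, so only f and its entries are rewritten *)
  have fb : f b = f a by rewrite ab.
  have sb u : ffun_upd a f u b = u by rewrite -ab ffun_upd_same.
  have sa u : ffun_upd b f u a = u by rewrite ab ffun_upd_same.
  transitivity
    (tconv phi (tconv (fun u => psi (Lam (ffun_upd a f u))) chi) (f a)).
    congr (tform _ _ _); apply: funext => u.
    rewrite tform_Dprec sb; congr (tform _ _ _).
    by apply: funext => v; rewrite -ab ffun_upd_upd.
  rewrite -fa fb; congr (tform _ _ _); apply: funext => u.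
  rewrite tform_Dsucc sa; congr (tform _ _ _).
  by apply: funext => v; rewrite -ab ffun_upd_upd.
under [X in tform _ X]funext => u do
  rewrite tform_Dprec ffun_upd_other 1?eq_sym //.
under [X in _ = tform X _ _]funext => u do
  rewrite tform_Dsucc ffun_upd_other //.
rewrite tform_exchange; congr (tform _ _ _); apply: funext => v.
congr (tform _ _ _); apply: funext => u.
by rewrite ffun_updC 1?eq_sym.
Qed.

Lemma tsucc_tsucc_Lam phi psi chi f : tassoc (f a) ->
  tsucc phi (tsucc psi chi) (Lam f) = tsucc (tconv phi psi) chi (Lam f).
Proof.
move=> fa; rewrite /tsucc !tform_Dsucc -[RHS]/(tconv _ _ _) fa.
congr (tform _ _ _); apply: funext => u.
rewrite tform_Dsucc ffun_upd_same; congr (tform _ _ _).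
by apply: funext => v; rewrite ffun_upd_upd.
Qed.

Lemma tprec_tprec_Lam phi psi chi f : tassoc (f b) ->
  tprec (tprec phi psi) chi (Lam f) = tprec phi (tconv psi chi) (Lam f).
Proof.
move=> fb; rewrite /tprec !tform_Dprec -[RHS]/(tconv _ _ _) -fb.
congr (tform _ _ _); apply: funext => u.
rewrite tform_Dprec ffun_upd_same; congr (tform _ _ _).
by apply: funext => v; rewrite ffun_upd_upd.
Qed.

(** Coassociativity of Delta, in dual form: expanding both sides by [tconvE]
gives the sums of the left and of the right sides of the three dendriform
identities. *)
Lemma tconvA phi psi chi t :
  tconv (tconv phi psi) chi t = tconv phi (tconv psi chi) t.
Proof.
elim/tree_finfun_ind: t phi psi chi => [|f IH] phi psi chi.
  by rewrite /tconv /tform /= !linextU /= mulrA.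
rewrite !tconvE -tsucc_tsucc_Lam // -tprec_tprec_Lam //.
have -> : tprec (tconv phi psi) chi (Lam f) =
    tprec (tsucc phi psi) chi (Lam f) + tprec (tprec phi psi) chi (Lam f).
  rewrite /tprec !tform_Dprec -tform_addl; congr (tform _ _ _).
  by apply: funext => u; rewrite tconvE.
have -> : tsucc phi (tconv psi chi) (Lam f) =
    tsucc phi (tsucc psi chi) (Lam f) + tsucc phi (tprec psi chi) (Lam f).
  rewrite /tsucc !tform_Dsucc -tform_addr; congr (tform _ _ _).
  by apply: funext => u; rewrite tconvE.
by rewrite tsucc_tprec_Lam // addrA.
Qed.

End Convolution.

(** * Grading of the half coproducts *)

Section Degrees.
Variables (k : fieldType) (p : nat).

(** Stated additively, as subtraction of natural numbers is truncated. *)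
Lemma tdeg_Lam_upd c (f : {ffun 'I_p -> tree p}) u :
  (tdeg (Lam (ffun_upd c f u)) + tdeg (f c) = tdeg (Lam f) + tdeg u)%N.
Proof.
rewrite /= (bigD1 c) //= [in RHS](bigD1 c) //= ffun_upd_same !addSn; congr _.+1.
rewrite (eq_bigr (fun j => tdeg (f j))) => [|j jc]; last first.
  by rewrite ffun_upd_other.
by rewrite addnC (addnC (tdeg u)) addnA.
Qed.

Variables a b : 'I_p.

Lemma Dsucc_graded t u v :
  (Dsucc k a b t)@_(u, v) != 0 -> (tdeg u + tdeg v = tdeg t)%N.
Proof.
case: t => [|f] /=; first by rewrite mcoeff0 eqxx.
case/linext_supp => -[s r] /Delta_tree_graded sr /basis_supp [<- <-].
by apply/(@addIn (tdeg (f a))); rewrite -addnA tdeg_Lam_upd -sr addnCA.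
Qed.

Lemma Dprec_graded t u v :
  (Dprec k a b t)@_(u, v) != 0 -> (tdeg u + tdeg v = tdeg t)%N.
Proof.
case: t => [|f] /=; first by rewrite mcoeff0 eqxx.
case/linext_supp => -[s r] /Delta_tree_graded sr /basis_supp [<- <-].
by apply/(@addIn (tdeg (f b))); rewrite addnAC tdeg_Lam_upd -sr addnA.
Qed.

End Degrees.

(** * Products on the augmentation ideal dual to graded coproducts *)

Section AugidealProduct.
Variables (k : fieldType) (p : nat).

Local Notation HH := {malg k[(tree p * tree p)%type]}.
Local Notation I := (augideal k p).

Definition coord (x : {malg k[tree p]} -> k) (t : tree p) : k := x << t >>.

Lemma gdual_linear (x : gdual k p) : linear (x : _ -> k^o).
Proof. by have /asboolP[] := valP x. Qed.

Lemma augideal_bounded (x : I) :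
  exists N, forall t, (N <= tdeg t)%N -> coord x t = 0.
Proof.
have /asboolP[_ [N xN]] := valP (val x); exists N => t Nt.
exact: xN Nt (homogeneousU k t).
Qed.

Lemma augideal_Empty (x : I) : coord x Empty = 0.
Proof. exact: (eqP (valP x)). Qed.

Lemma gdual_eq (x y : gdual k p) : coord x =1 coord y -> x = y.
Proof.
move=> xy; apply/val_inj/funext => h.
rewrite /= (linear_malgE (gdual_linear x)) (linear_malgE (gdual_linear y)).
by apply: (@eq_linext_supp k _ k^o) => t _; apply: xy.
Qed.

Lemma augideal_eq (x y : I) : coord x =1 coord y -> x = y.
Proof. by move=> xy; apply/val_inj/gdual_eq. Qed.

Lemma has_degreeP m (x : I) :
  has_degree m x <-> forall t, coord x t != 0 -> tdeg t = m.
Proof.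
split=> [dx t|dx n h nm /allP hn].
  by apply: contraNeq => tm; rewrite /coord (dx _ _ tm (homogeneousU k t)).
rewrite (linear_malgE (gdual_linear x)) linextE big_seq big1 // => t th.
have [->|/dx tm] := eqVneq (x << t >> : k^o) 0; first by rewrite scaler0.
by rewrite -tm (eqP (hn t th)) eqxx in nm.
Qed.

Lemma coord_linear c (x y : I) :
  coord (c *: x + y) = fun t => c * coord x t + coord y t.
Proof. by []. Qed.

Lemma coordD (x y : I) : coord (x + y) = fun t => coord x t + coord y t.
Proof. by []. Qed.

Variable D : tree p -> HH.
Hypothesis D_Empty : D Empty = 0.
Hypothesis D_graded : forall t u v,
  (D t)@_(u, v) != 0 -> (tdeg u + tdeg v = tdeg t)%N.

(** The product of x and y dual to the coproduct D; the grading of D bounds its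
support by the sum of the bounds for x and y. *)
Definition dual_form (x y : I) : {malg k[tree p]} -> k^o :=
  linext (fun t => tform (coord x) (coord y) (D t)).

Lemma coord_dual_form x y t :
  coord (dual_form x y) t = tform (coord x) (coord y) (D t).
Proof. by rewrite /coord /dual_form linextU. Qed.

Lemma dual_form_gdual x y : dual_form x y \in @gdual_pred k p.
Proof.
have [M xM] := augideal_bounded x; have [N yN] := augideal_bounded y.
apply/asboolP; split=> [c u v|]; first by rewrite /dual_form linearP.
exists (M + N)%N => m h le_m /allP hm.
rewrite /dual_form linextE big_seq big1 // => t /hm/eqP tm.
have [->|/tform_neq0[u [v [/D_graded uv xu yv]]]] :=
  eqVneq (tform (coord x) (coord y) (D t)) 0; first by rewrite scaler0.
have uM : (tdeg u < M)%N by rewrite ltnNge; apply: contra xu => /xM ->.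
have vN : (tdeg v < N)%N by rewrite ltnNge; apply: contra yv => /yN ->.
by move: le_m; rewrite -tm -uv leqNgt -addnS leq_add // ltnW.
Qed.

Definition dual_gdual x y : gdual k p := GDual (dual_form_gdual x y).

Lemma dual_gdual_augideal x y : dual_gdual x y \in @augideal_pred k p.
Proof.
by apply/eqP; rewrite /augmentation -[LHS]/(coord (dual_form x y) Empty)
  coord_dual_form D_Empty linear0.
Qed.

Definition dual_prod (x y : I) : I := AugIdeal (dual_gdual_augideal x y).

Lemma coord_dual_prod x y t :
  coord (dual_prod x y) t = tform (coord x) (coord y) (D t).
Proof. exact: coord_dual_form. Qed.

Lemma dual_prod_bilinear : bilinear_for *:%R *:%R dual_prod.
Proof.
split=> y c x1 x2; apply: augideal_eq => t.
  by rewrite coord_linear !coord_dual_prod coord_linear tform_linear_l.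
by rewrite coord_linear !coord_dual_prod coord_linear tform_linear_r.
Qed.

HB.instance Definition _ :=
  bilinear_isBilinear.Build k I I I *:%R *:%R dual_prod dual_prod_bilinear.

Lemma dual_prod_graded m n x y :
  has_degree m x -> has_degree n y -> has_degree (m + n) (dual_prod x y).
Proof.
move=> /has_degreeP dx /has_degreeP dy; apply/has_degreeP => t.
by rewrite coord_dual_prod => /tform_neq0[u [v [/D_graded <- /dx -> /dy ->]]].
Qed.

End AugidealProduct.

(** * The dendriform structure *)

Section DendriformStructure.
Variables (k : fieldType) (p : nat) (a b : 'I_p).

Local Notation I := (augideal k p).
Local Notation Dsucc_prod := (dual_prod (erefl : Dsucc k a b Empty = 0)
  (@Dsucc_graded k p a b)).
Local Notation Dprec_prod := (dual_prod (erefl : Dprec k a b Empty = 0)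
  (@Dprec_graded k p a b)).

Lemma coord_gmul (x y : I) :
  coord (gmul a b x y) =1 tconv a b (coord x) (coord y).
Proof. by move=> t; rewrite /coord /= /conv /Delta linextU. Qed.

Lemma coord_Dprec_prod (x y : I) :
  coord (Dprec_prod x y) = tprec a b (coord x) (coord y).
Proof. by apply/funext => t; rewrite coord_dual_prod. Qed.

Lemma coord_Dsucc_prod (x y : I) :
  coord (Dsucc_prod x y) = tsucc a b (coord x) (coord y).
Proof. by apply/funext => t; rewrite coord_dual_prod. Qed.

(** The halves of the coproduct add up to Delta except at the empty tree, where
Delta has the value Empty (x) Empty, on which elements of the augmentation ideal
vanish. *)
Lemma tconv_augideal (x y : I) :
  tconv a b (coord x) (coord y) = coord (Dprec_prod x y + Dsucc_prod x y).
Proof.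
apply/funext => t; rewrite coordD !coord_dual_prod.
case: t => [|f]; last by rewrite addrC tconvE.
by rewrite !linear0 /tconv /tform /= linextU /= !augideal_Empty mulr0 addr0.
Qed.

Lemma dual_prec_prec (x y z : I) :
  Dprec_prod (Dprec_prod x y) z =
  Dprec_prod x (Dprec_prod y z) + Dprec_prod x (Dsucc_prod y z).
Proof.
apply: augideal_eq => -[|f]; first by rewrite !augideal_Empty.
rewrite coordD !coord_Dprec_prod tprec_tprec_Lam => [|? ? ?]; last first.
  exact: tconvA.
by rewrite tconv_augideal coordD /tprec tform_addr coord_Dprec_prod.
Qed.

Lemma dual_succ_prec (x y z : I) :
  Dsucc_prod x (Dprec_prod y z) = Dprec_prod (Dsucc_prod x y) z.
Proof.
apply: augideal_eq => -[|f]; first by rewrite !augideal_Empty.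
rewrite !(coord_Dprec_prod, coord_Dsucc_prod) tsucc_tprec_Lam // => ? ? ?.
exact: tconvA.
Qed.

Lemma dual_succ_succ (x y z : I) :
  Dsucc_prod x (Dsucc_prod y z) =
  Dsucc_prod (Dprec_prod x y) z + Dsucc_prod (Dsucc_prod x y) z.
Proof.
apply: augideal_eq => -[|f]; first by rewrite !augideal_Empty.
rewrite coordD !coord_Dsucc_prod tsucc_tsucc_Lam => [|? ? ?]; last first.
  exact: tconvA.
by rewrite tconv_augideal coordD /tsucc tform_addl coord_Dsucc_prod.
Qed.

Definition augideal_dendriform : dendriform I := @Dendriform k I
  Dprec_prod Dsucc_prod dual_prec_prec dual_succ_prec dual_succ_succ.

End DendriformStructure.

Theorem proposition9p3 (k : fieldType) (p : nat) (hp : (1 <= p)%N)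
    (a b : 'I_p) :
  exists D : dendriform (augideal k p),
    graded_dendriform (@has_degree k p) D /\
    (forall x y : augideal k p, gmul a b x y = dassoc D x y :> gdual k p).
Proof.
exists (augideal_dendriform k a b); split=> [m n x y dx dy|x y].
  by split; apply: dual_prod_graded.
apply: gdual_eq => t; rewrite coord_gmul.
by rewrite tconv_augideal.
Qed.
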